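(* Let $\mathcal C$ be a class of asymptotically free compositions and let the number of compositions of $n$ in $\mathcal C$ be asymptotic to $Ar^{-n}$. Suppose that there is some $\ell$ such that, whenever the number of parts in each of the compositions $\mathbf a$ and $\mathbf b$ is at least $\ell$, we have that $\mathbf a\,x\,\mathbf b\in\mathcal C$ for infinitely many positive integers $x$ if and only if $\mathbf a\in\mathcal C$ and $\mathbf b\in\mathcal C$. Then $C=A$, where $C$ is the constant defined below.
   Context: A composition is a finite sequence $\mathbf c=c_1\cdots c_k$ of positive integers; ${\rm len}(\mathbf c)=k$, $\Sigma(\mathbf c)=\sum_i c_i$, and $\mathbf c$ is a composition of $n$ if $\Sigma(\mathbf c)=n$. A subcomposition is a nonempty block of consecutive parts; juxtaposition denotes concatenation. For $m,p\in\mathbb N$, a local restriction function of type $(m,p)$ is $\phi:\{0,\dots,m-1\}\times\mathbb N_0^{p+1}\to\{0,1\}$ with $\phi(i;0,\dots,0)=1$ for all $i$. $\mathcal C_\phi$ is the set of compositions $\mathbf c$ with $\phi(i\bmod m;c_i,c_{i-1},\dots,c_{i-p})=1$ for all $i\in\mathbb Z$, where $c_j:=0$ if $j<1$ or $j>{\rm len}(\mathbf c)$; $\mathcal C_\Phi=\bigcup_{\phi\in\Phi}\mathcal C_\phi$. A subcomposition $\mathbf s$ is recurrent at $j$ modulo $m$ in $\mathcal C_\phi$ if for every $k$ and every $\mathbf a\mathbf x\mathbf z\in\mathcal C_\phi$ with ${\rm len}(\mathbf a),{\rm len}(\mathbf z)\ge p$ there is $\mathbf a\mathbf y\mathbf z\in\mathcal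 C_\phi$ containing at least $k$ copies of $\mathbf s$ starting at positions $\equiv j$ mod $m$; recurrent = recurrent at some $j$. $\phi$ is recurrent if every subcomposition $c_i\cdots c_j$ of every $\mathbf c\in\mathcal C_\phi$ with $i>p$, $j+p\le{\rm len}(\mathbf c)$ is recurrent. Recurrent $\phi,\phi'$ of the same type are similar if there is $k$ with: $\mathbf s$ recurrent at $j$ mod $m$ in $\mathcal C_\phi$ iff recurrent at $j+k$ mod $m$ in $\mathcal C_{\phi'}$. $\phi$ is asymptotically free if it is recurrent and (a) whenever $\mathbf r(x)=r_1\cdots r_p\,x\,r_{p+2}\cdots r_{2p+1}$ is recurrent at $j$ mod $m$ for infinitely many $x$, there is $M$ such that whenever $\mathbf r(x)$ occurs at a position $\equiv j$ mod $m$ in a composition of $\mathcal C_\phi$, $x$ may be replaced by any $x'\ge M$ staying in $\mathcal C_\phi$; (b) at least one such $j,r_i$ exist. A class of asymptotically free compositions is $\mathcal C_\Phi$ for a finite set $\Phi$ of pairwise similar local restriction functions at least one of which is asymptotically free. It is known that the number of compositions of $n$ in such a class is $\sim Ar^{-n}$ with $A>0$, $0<r<1$. For a uniformly random composition of $n$ in $\mathcal C$ let $X_0(n)$ be the number of parts and $X_k(n)$ the number of parts equal to $k$; the limits $u_k=\lim_n\mathsf E(X_k(n))/\mathsf E(X_0(n))$ exist and $u_k\sim Br^k$ ($k\to\infty$) for a constant $B>0$; $C:=B\lim_{n\to\infty}\mathsf E(X_0(n))/n$. *)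

(* Defs.v *)
From HB Require Import structures.
From mathcomp Require Import all_boot all_order all_algebra finmap.
From mathcomp Require Import all_classical all_reals all_analysis.

Set Implicit Arguments.
Unset Strict Implicit.
Unset Printing Implicit Defensive.

Import Order.TTheory GRing.Theory Num.Theory.
Import numFieldNormedType.Exports.

Local Open Scope classical_set_scope.
Local Open Scope nat_scope.

(* A composition is a [seq nat] with positive entries (possibly empty); its
   length is [size] and the number it composes is [sumn].  Positions are
   1-based, as in c_1 ... c_k. *)
Definition composition (c : seq nat) : bool := all (leq 1) c.

Definition part (c : seq nat) (j : int) : nat :=
  if (0 < j)%R then nth 0 c `|j|%N.-1 else 0.

Record restriction (m p : nat) := Restriction {
  allowed :> 'I_m -> p.+1.-tuple nat -> bool;
  allowed0 : forall i : 'I_m, allowed i [tuple of nseq p.+1 0]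
}.

Section Restrictions.
Variables m p : nat.
Implicit Types phi psi : restriction m p.

(* (c_i, c_{i-1}, ..., c_{i-p}) *)
Definition window (c : seq nat) (i : int) : p.+1.-tuple nat :=
  [tuple part c (i - t%:Z)%R | t < p.+1].

(* For m > 0, exactly one k : 'I_m is congruent to i. *)
Definition comps phi : set (seq nat) :=
  [set c | composition c /\
    forall (i : int) (k : 'I_m),
      (i = (k : nat)%:Z %[mod m%:Z])%Z -> phi k (window c i)].

Definition subcomposition (s : seq nat) : Prop := s != [::] /\ composition s.

(* Copies may overlap. *)
Definition copies (s : seq nat) (j : nat) (c : seq nat) : nat :=
  count (fun i => prefix s (drop i.-1 c) && (i == j %[mod m]))
        (iota 1 (size c)).

Definition recurrent_at phi (s : seq nat) (j : nat) : Prop :=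
  subcomposition s /\
  forall (k : nat) (a x z : seq nat),
    p <= size a -> p <= size z -> comps phi (a ++ x ++ z) ->
    exists y : seq nat,
      comps phi (a ++ y ++ z) /\ k <= copies s j (a ++ y ++ z).

Definition recurrent phi : Prop :=
  forall a s z : seq nat,
    comps phi (a ++ s ++ z) -> s != [::] -> p <= size a -> p <= size z ->
    exists j : nat, recurrent_at phi s j.

Definition similar phi psi : Prop :=
  [/\ recurrent phi, recurrent psi &
    exists k : nat, forall (s : seq nat) (j : nat),
      recurrent_at phi s j <-> recurrent_at psi s (j + k)].

(* The pattern r(x) is [l ++ x :: q]. *)
Definition infinitely_recurrent phi (l q : seq nat) (j : nat) : Prop :=
  infinite_set [set x : nat | recurrent_at phi (l ++ x :: q) j].

Definition asymptotically_free phi : Prop :=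
  [/\ recurrent phi,
      forall (l q : seq nat) (j : nat), size l = p -> size q = p ->
        infinitely_recurrent phi l q j ->
        exists M : nat, forall (u v : seq nat) (x : nat),
          comps phi (u ++ (l ++ x :: q) ++ v) ->
          (size u).+1 = j %[mod m] ->
          forall x' : nat, M <= x' -> comps phi (u ++ (l ++ x' :: q) ++ v) &
      exists (l q : seq nat) (j : nat),
        [/\ size l = p, size q = p & infinitely_recurrent phi l q j]].

End Restrictions.

Definition asymptotically_free_class (C : set (seq nat)) : Prop :=
  exists m p : nat, [/\ 0 < m, 0 < p &
    exists Phi : set (restriction m p),
      [/\ finite_set Phi,
          forall phi psi, Phi phi -> Phi psi -> similar phi psi,
          exists2 phi, Phi phi & asymptotically_free phi &
          C = \bigcup_(phi in Phi) comps phi]].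

Definition comps_of (C : set (seq nat)) (n : nat) : set (seq nat) :=
  [set c | C c /\ sumn c = n].

(* [fset_set] is meaningful here: [comps_of C n] is finite for every class of
   compositions. *)
Lemma finite_comps_of (C : set (seq nat)) (n : nat) :
  C `<=` [set c | composition c] -> finite_set (comps_of C n).
Proof.
move=> CC.
have bnd c : composition c -> size c <= sumn c /\ all (fun x => x <= sumn c) c.
  elim: c => //= x c IH /andP[x0 /IH[h1 h2]]; split.
    by rewrite -add1n leq_add.
  rewrite leq_addr /=; apply: sub_all h2 => y /leq_trans; apply.
  exact: leq_addl.
pose f (t : {k : 'I_n.+1 & k.-tuple 'I_n.+1}) : seq nat :=
  [seq nat_of_ord i | i <- tagged t].
apply: (@sub_finite_set _ _ (f @` setT)); last exact/finite_image/finite_finset.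
move=> c [/CC /= cc sc]; have [h1 h2] := bnd _ cc; rewrite sc in h1 h2.
pose s := [seq inord i : 'I_n.+1 | i <- c].
have hs : size s == Ordinal (h1 : size c < n.+1) by rewrite size_map.
exists (Tagged (fun k : 'I_n.+1 => k.-tuple 'I_n.+1) (Tuple hs)) => //.
rewrite /f /= -map_comp -[RHS]map_id; apply/eq_in_map => x xc /=.
by rewrite inordK // ltnS (allP h2).
Qed.

Definition num_comps (C : set (seq nat)) (n : nat) : nat :=
  (#|` fset_set (comps_of C n)|)%fset.

(* X_0 counts all parts, X_k for k > 0 counts the parts equal to k. *)
Definition num_parts (k : nat) (c : seq nat) : nat :=
  if k == 0 then size c else count_mem k c.

(* E(X_k(n)) for a uniformly random element of [comps_of C n]. *)
Definition mean_parts (R : realType) (C : set (seq nat)) (k n : nat) : R :=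
  ((\sum_(c <- fset_set (comps_of C n)) (num_parts k c)%:R)
     / (num_comps C n)%:R)%R.

Definition part_ratio (R : realType) (C : set (seq nat)) (k n : nat) : R :=
  (mean_parts R C k n / mean_parts R C 0 n)%R.

Definition part_freq (R : realType) (C : set (seq nat)) (k : nat) : R :=
  limn (part_ratio R C k).

Definition part_density (R : realType) (C : set (seq nat)) (n : nat) : R :=
  (mean_parts R C 0 n / n%:R)%R.

(* Main.v *)
Require Import Defs.
From HB Require Import structures.
From mathcomp Require Import all_boot all_order all_algebra finmap.
From mathcomp Require Import all_classical all_reals all_analysis.
From mathcomp Require Import zify ring lra.

Set Implicit Arguments.
Unset Strict Implicit.
Unset Printing Implicit Defensive.

Import Order.TTheory GRing.Theory Num.Theory.
Import numFieldNormedType.Exports.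

Local Open Scope classical_set_scope.
Local Open Scope ring_scope.

(* Call a pair of words [(a, b)] good when both are long and the [p] parts on
   either side of the cut are at most [K].  Up to restriction functions and
   residues modulo [m], good pairs present finitely many local patterns at the
   cut, so asymptotic freeness and the hypothesis on the class give one bound
   [M] such that, for [k >= M], [a k b] is in [C] iff [a] and [b] are.  Hence the
   number of parts [k] in the members of [C] of weight [n] is the convolution of
   the counting sequence of [C] with itself at [n - k], up to bad pairs.
   Bad pairs are rare because the numbers of prefixes and of suffixes of members
   of [C] are still [O(r^-n)]: a prefix either ends with [p] parts at most [K],
   in which case finitely many words suffice to complete all such prefixes into
   members of [C], or it ends with a block of [p] parts one of which exceeds [K],
   and such blocks have generating function at most 1/2 at [r] for large [K].
   So bad pairs number [O(n r^K + 1) r^(k-n)], and the frequency of [k] is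
   [A r^k / mu] up to a relative error [O(r^K)]; let [k], then [K], grow. *)

(** * Local restrictions and recurrence *)

Section LocalRestrictions.
Local Open Scope nat_scope.

Lemma part_catl (u w : seq nat) (j : int) :
  (j <= (size u)%:Z)%R -> part (u ++ w) j = part u j.
Proof.
rewrite /part => hj; case: ifP => // j0.
by rewrite nth_cat; have -> : `|j|.-1 < size u by lia.
Qed.

Lemma part_catr (u w : seq nat) (j : int) :
  (0 < j)%R -> part (u ++ w) ((size u)%:Z + j)%R = part w j.
Proof.
rewrite /part => hj; rewrite hj; have -> : (0 < (size u)%:Z + j)%R by lia.
rewrite nth_cat; have -> : `|((size u)%:Z + j)%R|.-1 < size u = false by lia.
by congr nth; lia.
Qed.

Variables m p : nat.
Implicit Types phi psi : restriction m p.

(** A window spans [p.+1] parts, so none reaches across the [p] parts of [l]: a window ending at or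
    before the end of [l] sees only [u ++ l], and a later one sees only [l ++ v']. In the latter
    case it is a window of the second composition, moved by a multiple of [m]. *)
Lemma comps_exchange phi (u u' l v v' : seq nat) :
  size l = p -> size u = size u' %[mod m] ->
  comps phi (u ++ l ++ v) -> comps phi (u' ++ l ++ v') ->
  comps phi (u ++ l ++ v').
Proof.
move=> sl su [c1 h1] [c2 h2]; split.
  move: c1 c2; rewrite /composition !all_cat.
  by move=> /and3P[-> -> _] /and3P[_ _ ->].
move=> i k ik; have [hi|hi] := leP i ((size u + p)%N%:Z).
  suff -> : window p (u ++ l ++ v') i = window p (u ++ l ++ v) i by apply: h1.
  apply: eq_from_tnth => t; rewrite !tnth_mktuple !catA.
  by rewrite !(@part_catl (u ++ l)) // size_cat; lia.
have hw : window p (u ++ l ++ v') i =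
    window p (u' ++ l ++ v') (i - (size u)%:Z + (size u')%:Z)%R.
  apply: eq_from_tnth => t; rewrite !tnth_mktuple.
  have ht := ltn_ord t; pose j : int := (i - (size u)%:Z - t%:Z)%R.
  have -> : (i - t%:Z = (size u)%:Z + j)%R by rewrite /j; lia.
  have -> : (i - (size u)%:Z + (size u')%:Z - t%:Z = (size u')%:Z + j)%R.
    by rewrite /j; lia.
  by rewrite !part_catr // /j; lia.
rewrite hw; apply: h2; rewrite -ik; apply/eqP.
rewrite -addrA -[X in (_ == X %[mod _])%Z]addr0 eqz_modDl eqz_mod_dvd subr0.
by rewrite addrC -eqz_mod_dvd !modz_nat su eqxx.
Qed.

(** Two exchanges: one at [l] brings in [x' :: q ++ v'], and one at [q] restores the tail [v]. The
    second is possible because [x] and [x'] each take up one position. *)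
Lemma comps_exchange_mid phi (u u' l q v v' : seq nat) (x x' : nat) :
  size l = p -> size q = p -> size u = size u' %[mod m] ->
  comps phi (u ++ (l ++ x :: q) ++ v) ->
  comps phi (u' ++ (l ++ x' :: q) ++ v') ->
  comps phi (u ++ (l ++ x' :: q) ++ v).
Proof.
move=> sl sq su h1 h2.
have h3 : comps phi (u ++ l ++ ((x' :: q) ++ v')).
  apply: (comps_exchange sl su (v := (x :: q) ++ v)).
    by move: h1; rewrite -!catA.
  by move: h2; rewrite -!catA.
have := @comps_exchange phi (u ++ l ++ [:: x']) (u ++ l ++ [:: x]) q v' v sq.
rewrite -!catA /=; apply => //; first by rewrite !size_cat.
by move: h1; rewrite -!catA.
Qed.

Lemma copies_modn (s : seq nat) j j' (c : seq nat) :
  j = j' %[mod m] -> copies m s j c = copies m s j' c.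
Proof. by move=> e; apply: eq_count => i; rewrite e. Qed.

Lemma recurrent_at_modn phi s j j' :
  j = j' %[mod m] -> recurrent_at phi s j -> recurrent_at phi s j'.
Proof.
move=> e [h1 h2]; split=> // k a x z pa pz h.
by have [y [hy ky]] := h2 k a x z pa pz h; exists y; rewrite -(copies_modn _ _ e).
Qed.

(** Shifting a position by [size u] is injective and sends copies of the long word to copies of [s];
    as [s] is nonempty, the shifted position does not run past the end of [c]. *)
Lemma leq_copies_infix (u s v : seq nat) j c :
  s != [::] -> copies m (u ++ s ++ v) j c <= copies m s (j + size u) c.
Proof.
move=> s0; rewrite /copies -!size_filter -(size_map (addn (size u))).
apply: uniq_leq_size => [|i].
  by rewrite map_inj_uniq ?filter_uniq ?iota_uniq // => x y /addnI.
case/mapP => k; rewrite mem_filter mem_iota => /andP[/andP[pk /eqP hk] /andP[k1 k2]] ->.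
have sz : 0 < size s by rewrite lt0n size_eq0.
have [w hw] : exists w, drop k.-1 c = (u ++ s ++ v) ++ w by apply/prefixP.
have hs : size c = k.-1 + size (drop k.-1 c) by rewrite size_drop; lia.
rewrite hw !size_cat in hs.
rewrite mem_filter mem_iota; apply/andP; split; last by lia.
apply/andP; split; last by rewrite addnC eqn_modDr hk.
have -> : (size u + k).-1 = size u + k.-1 by lia.
by rewrite -drop_drop hw -!catA drop_size_cat // prefix_prefix.
Qed.

Lemma recurrent_at_infix phi (u s v : seq nat) j :
  s != [::] -> recurrent_at phi (u ++ s ++ v) j ->
  recurrent_at phi s (j + size u).
Proof.
move=> s0 [[_ cs] h]; split.
  by split=> //; move: cs; rewrite /composition !all_cat => /and3P[].
move=> k a x z pa pz hc; have [y [hy ky]] := h k a x z pa pz hc.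
by exists y; split=> //; rewrite (leq_trans ky) // leq_copies_infix.
Qed.

Lemma copies_inside (s : seq nat) j (a y z : seq nat) :
  size a + size s + size z < copies m s j (a ++ y ++ z) ->
  exists y1 y2, y = y1 ++ s ++ y2 /\ (size a + size y1).+1 = j %[mod m].
Proof.
set c := a ++ y ++ z => hk.
have sc : size c = size a + size y + size z by rewrite !size_cat addnA.
pose P i := prefix s (drop i.-1 c) && (i == j %[mod m]).
have [i [hi /and3P[/andP[pi /eqP mi] ai si]]] : exists i : nat, 0 < i <= size c /\
    [&& P i, size a < i & i.-1 + size s <= size a + size y].
  apply: contrapT => hn; move: hk; apply/negP; rewrite -leqNgt.
  rewrite /copies -size_filter.
  (* These are the starts that must be excluded: those in [a], and those from the first position at
     which a copy would stick out of [a ++ y]. If no copy lay inside [y], all copies would start at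
     one of them. *)
  have -> : size a + size s + size z =
     size (iota 1 (size a) ++ iota (size a + size y + 2 - size s) (size s + size z)).
    by rewrite size_cat !size_iota addnA.
  apply: uniq_leq_size; first by rewrite filter_uniq ?iota_uniq.
  move=> i; rewrite mem_filter mem_iota mem_cat !mem_iota => /andP[Pi hi].
  have : ~~ ((size a < i) && (i.-1 + size s <= size a + size y)).
    apply/negP => hi'; apply: hn; exists i; split; first by lia.
    by apply/andP; split.
  lia.
pose d := i.-1 - size a.
have ed : i.-1 = d + size a by rewrite /d; lia.
have dy : d <= size y by lia.
move: pi; rewrite ed -drop_drop drop_size_cat // drop_cat.
have hd : drop d y ++ z = if d < size y then drop d y ++ z else drop (d - size y) z.
  case: ltnP => // ?; have -> : d = size y by lia.
  by rewrite drop_size subnn drop0.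
have hsz : size s <= size (drop d y) by rewrite size_drop; lia.
rewrite -hd prefixE takel_cat //.
move=> /eqP hs; exists (take d y), (drop (size s) (drop d y)); split.
  by rewrite -{1}(cat_take_drop d y) -{1}(cat_take_drop (size s) (drop d y)) hs.
by rewrite size_takel // -mi; congr modn; lia.
Qed.

Hypothesis m_gt0 : 0 < m.

(* The residues [d] at which [s] is recurrent are all realised inside one block
   [s ++ y] starting at the position of [s]; that block is recurrent at some
   shift [e], so the set of these residues, with the one of the given occurrence
   added, is mapped into itself by adding [e].  Adding [e] [m] times brings the
   occurrence back to its own residue. *)
Lemma recurrent_at_occurrence phi (a s z : seq nat) :
  recurrent phi -> comps phi (a ++ s ++ z) -> s != [::] ->
  p <= size a -> p <= size z -> recurrent_at phi s (size a).+1.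
Proof.
move=> rphi hc s0 pa pz.
have [y [hy occ]] : exists y, comps phi (a ++ (s ++ y) ++ z) /\
    forall d, d \in iota 0 m -> recurrent_at phi s d -> exists y1 y2,
      s ++ y = y1 ++ s ++ y2 /\ (size a + size y1).+1 = d %[mod m].
  elim: (iota 0 m) => [|d ds [y [hy IH]]]; first by exists [::]; rewrite cats0.
  have [rd|nrd] := pselect (recurrent_at phi s d); last first.
    exists y; split=> // d'; rewrite inE => /orP[/eqP -> //|]; exact: IH.
  (* The whole block built so far is used as the left margin, with an empty middle. The new copy
     thus falls in the appended [y'], and the copies found for earlier residues are kept. *)
  have [_ /(_ (size (a ++ s ++ y) + size s + size z).+1 (a ++ s ++ y) [::] z)] := rd.
  case=> [|//||y' [hy' /copies_inside [y1 [y2 [ey ed]]]]].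
  - by rewrite size_cat; lia.
  - by move: hy; rewrite -!catA.
  exists (y ++ y'); split; first by move: hy'; rewrite -!catA.
  move=> d'; rewrite inE => /orP[/eqP -> _|/IH h /h[w1 [w2 [ew hw]]]].
    exists (s ++ y ++ y1), y2; rewrite -ed !size_cat ey -!catA; split=> //.
    by congr modn; lia.
  by exists w1, (w2 ++ y'); rewrite catA ew -!catA.
have sy0 : s ++ y != [::] by case: (s) s0.
have [j rj] := rphi _ _ _ hy sy0 pa pz.
(* The term [m.-1 * i] plays the part of [- i] modulo [m], so [e] is [j - i] without a truncated
   subtraction. *)
pose i := (size a).+1; pose e := j + m.-1 * i.
have ie : i + e = j %[mod m].
  rewrite (_ : i + e = i * m + j) ?modnMDl // /e; case: (m) m_gt0 => // m' _ /=; lia.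
have re : recurrent_at phi s (i + e).
  apply: recurrent_at_modn (esym ie) _.
  by have := @recurrent_at_infix phi [::] s y j s0 rj; rewrite addn0.
have step d : recurrent_at phi s d -> recurrent_at phi s (d + e).
  move=> rd; have [||y1 [y2 [ey ed]]] := occ (d %% m).
  - by rewrite mem_iota /= ltn_mod.
  - by apply: recurrent_at_modn rd; rewrite modn_mod.
  rewrite ey in rj; have := recurrent_at_infix s0 rj.
  apply: recurrent_at_modn.
  rewrite modn_mod in ed.
  by rewrite -modnDml -ie modnDml -(modnDml d) -ed modnDml; congr modn; rewrite /i; lia.
have all_t t : recurrent_at phi s (i + t.+1 * e).
  elim: t => [|t IH]; first by rewrite mul1n.
  by have := step _ IH; rewrite -addnA -mulSnr.
have := all_t m.-1; rewrite prednK //; apply: recurrent_at_modn.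
by rewrite addnC mulnC modnMDl.
Qed.

(** Similarity moves the question to [psi]. There, recurrence for one [x] puts the pattern deep
    inside a composition, asymptotic freeness replaces [x] by any large [x'], and
    [recurrent_at_occurrence] makes the resulting occurrence recurrent at the right residue. *)
Lemma recurrent_cofinite phi psi (l q : seq nat) j :
  Defs.similar phi psi -> asymptotically_free psi -> size l = p -> size q = p ->
  infinitely_recurrent phi l q j ->
  exists M, forall x, M <= x -> recurrent_at phi (l ++ x :: q) j.
Proof.
move=> [_ rpsi [k sim]] [_ af _] sl sq inf.
have inf' : infinitely_recurrent psi l q (j + k).
  apply: contra_not inf => fin; apply: sub_finite_set fin => x /=.
  by move/sim.
have [M hM] := af l q (j + k) sl sq inf'.
have [x /= rx] : exists x, recurrent_at psi (l ++ x :: q) (j + k).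
  by have [x rx] := infinite_setN0 inf'; exists x.
(* The bound 1 makes [x'] a positive part. *)
exists (maxn M 1) => x'; rewrite geq_max => /andP[Mx' x'0]; apply/sim.
have sub' : subcomposition (l ++ x' :: q).
  split; first by case: (l).
  by case: rx => [[_]]; rewrite /composition !all_cat /= x'0 => /and3P[-> _ ->].
(* When no composition of [psi] has room for both margins, recurrence in [psi]
   is vacuous. *)
have [[a [y [z [pa pz hc]]]]|no] := pselect (exists a y z,
    [/\ p <= size a, p <= size z & comps psi (a ++ y ++ z)]); last first.
  split=> // ? a y z pa pz hc; case: no; by exists a, y, z.
have [_ /(_ (size a + size (l ++ x :: q) + size z).+1 _ _ _ pa pz hc)] := rx.
case=> y' [hy' /copies_inside[y1 [y2 [ey ej]]]].
have hc' : comps psi ((a ++ y1) ++ (l ++ x' :: q) ++ (y2 ++ z)).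
  apply: (hM _ _ x) => //; last by rewrite size_cat.
  by move: hy'; rewrite ey -!catA.
have := recurrent_at_occurrence rpsi hc' (proj1 sub').
rewrite !size_cat => h; apply: recurrent_at_modn ej _; apply: h; lia.
Qed.

(** If the pattern is recurrent at [j.+1] for finitely many [x] only, no larger [x] can occur there.
    Otherwise it is recurrent for every large [x]; one admissible large [x] between [u] and [v] then
    yields a composition containing the pattern with any other large centre, and that centre is
    carried back by [comps_exchange_mid]. Neither bound depends on [u] or [v]. *)
Lemma comps_dichotomy phi psi (l q : seq nat) j :
  Defs.similar phi psi -> asymptotically_free psi -> size l = p -> size q = p ->
  exists M, forall u v, p <= size u -> p <= size v -> size u = j %[mod m] ->
    (forall x, M <= x -> comps phi (u ++ (l ++ x :: q) ++ v)) \/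
    (forall x, M <= x -> ~ comps phi (u ++ (l ++ x :: q) ++ v)).
Proof.
move=> sim af sl sq.
have occ u v x : p <= size u -> p <= size v -> size u = j %[mod m] ->
    comps phi (u ++ (l ++ x :: q) ++ v) -> recurrent_at phi (l ++ x :: q) j.+1.
  move=> pu pv uj hc; apply: (@recurrent_at_modn phi _ (size u).+1).
    by rewrite -addn1 -modnDml uj modnDml addn1.
  apply: recurrent_at_occurrence hc _ pu pv; first by case: sim.
  by case: (l).
have [fin|inf] := pselect (finite_set [set x | recurrent_at phi (l ++ x :: q) j.+1]).
  have [s hs] := (finite_seqP _).1 fin; exists (\max_(x <- s) x).+1 => u v pu pv uj.
  right=> x Mx /(occ u v x pu pv uj) rx.
  have xs : x \in s by have : [set` s] x by rewrite -hs.
  by move: Mx; apply/negP; rewrite -leqNgt; apply: (leq_bigmax_seq x xs).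
have [M hM] := recurrent_cofinite sim af sl sq inf; exists M => u v pu pv uj.
have [[x [Mx hx]]|no] := pselect (exists x,
    M <= x /\ comps phi (u ++ (l ++ x :: q) ++ v)).
  left=> x' Mx'; have [_ h] := hM _ Mx'.
  have [y [hy]] := h 1 _ _ _ pu pv hx.
  rewrite -has_count => /hasP[i]; rewrite mem_iota => hi /andP[/prefixP[w hw] /eqP ij].
  apply: (comps_exchange_mid sl sq _ hx (u' := take i.-1 (u ++ y ++ v)) (v' := w)).
    rewrite size_takel; last by lia.
    rewrite uj; apply/eqP; rewrite -(eqn_modDr 1) !addn1 prednK; last by lia.
    by rewrite ij.
  by rewrite -hw cat_take_drop.
by right=> x Mx hx; apply: no; exists x.
Qed.

End LocalRestrictions.

(** * Cutting the members of a class at a large part *)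

Section Classes.
Local Open Scope nat_scope.

Definition prefixes (C : set (seq nat)) : set (seq nat) :=
  [set a | exists b, C (a ++ b)].

Definition suffixes (C : set (seq nat)) : set (seq nat) :=
  [set b | exists a, C (a ++ b)].

Definition small (K : nat) : pred (seq nat) := all (leq^~ K).

Lemma finite_small p K : finite_set [set l : seq nat | size l = p /\ small K l].
Proof.
apply: (@sub_finite_set _ _
  ((fun t : p.-tuple 'I_K.+1 => map val t) @` setT)); last first.
  exact/finite_image/finite_finset.
move=> l [sl /allP hl].
have h : size [seq inord i : 'I_K.+1 | i <- l] == p by rewrite size_map sl.
exists (Tuple h) => //=; rewrite -map_comp -[RHS]map_id.
by apply/eq_in_map => x /hl xK /=; rewrite inordK.
Qed.

Lemma finite_uniform_bound T (S : set T) (P : T -> nat -> Prop) :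
  finite_set S -> (forall s M M', M <= M' -> P s M -> P s M') ->
  (forall s, S s -> exists M, P s M) -> exists M, forall s, S s -> P s M.
Proof.
move=> finS mono ex.
have /choice[f hf] s : exists M, S s -> P s M.
  by have [/ex[M]|nS] := pselect (S s); [exists M | exists 0].
have [r hr] := (finite_seqP _).1 (finite_image f finS).
exists (\max_(x <- r) x) => s Ss; apply: mono (hf s Ss).
have fr : f s \in r by have : [set` r] (f s) by rewrite -hr; exists s.
exact: (leq_bigmax_seq _ fr).
Qed.

Variables (m p : nat) (Phi : set (restriction m p)).
Hypotheses (m_gt0 : 0 < m) (finPhi : finite_set Phi).
Let C := \bigcup_(phi in Phi) comps phi.

(** A type consists of a restriction function, the [p] small parts next to a cut, and the residue of
    the length of what precedes these parts. By [comps_exchange] this is all that decides how a word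
    can be continued. *)
Lemma finite_types K : finite_set (Phi `*`
  ([set l : seq nat | size l = p /\ small K l] `*` `I_m)).
Proof.
by apply: finite_setX => //; apply: finite_setX; [exact: finite_small|exact: finite_II].
Qed.

(** For each type choose one continuation that follows some word of this type; by exchange it also
    completes every prefix of the same type. *)
Lemma prefix_completions K : exists bs : seq (seq nat), forall a,
  prefixes C a -> p <= size a -> small K (drop (size a - p) a) ->
  exists2 b, b \in bs & C (a ++ b).
Proof.
pose P (t : restriction m p * (seq nat * nat)) u v :=
  size u = t.2.2 %[mod m] /\ comps t.1 (u ++ t.2.1 ++ v).
have /choice[f hf] t : exists v, (exists u v', P t u v') -> exists u, P t u v.
  (* The empty word is a dummy value for types that never occur. *)
  have [[u [v h]]|no] := pselect (exists u v, P t u v); last by exists [::].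
  by exists v => _; exists u.
have [bs hbs] := (finite_seqP _).1 (finite_image f (finite_types K)).
exists bs => a [b [phi Pphi hab]] pa sa.
pose u := take (size a - p) a; pose l := drop (size a - p) a.
have ea : a = u ++ l by rewrite cat_take_drop.
have sl : size l = p by rewrite size_drop subKn.
pose t := (phi, (l, size u %% m)).
have ht : exists u v, P t u v.
  by exists u, b; split; rewrite /= ?modn_mod // catA -ea.
have [u' [su' hu']] := hf t ht; rewrite /= modn_mod in su'.
exists (f t).
  have : [set` bs] (f t); last by [].
  by rewrite -hbs; exists t => //=; rewrite ltn_mod.
exists phi => //; rewrite ea -catA.
apply: (comps_exchange sl (esym su') (v := b)) => //; by rewrite catA -ea.
Qed.

(** The mirror image: for each type choose one beginning whose length has the residue recorded in
    the type. *)
Lemma suffix_completions K : exists cs : seq (seq nat), forall b,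
  suffixes C b -> p <= size b -> small K (take p b) ->
  exists2 a, a \in cs & C (a ++ b).
Proof.
pose P (t : restriction m p * (seq nat * nat)) u v :=
  size u = t.2.2 %[mod m] /\ comps t.1 (u ++ t.2.1 ++ v).
have /choice[f hf] t : exists u, (exists u' v, P t u' v) -> exists v, P t u v.
  have [[u [v h]]|no] := pselect (exists u v, P t u v); last by exists [::].
  by exists u => _; exists v.
have [cs hcs] := (finite_seqP _).1 (finite_image f (finite_types K)).
exists cs => b [a [phi Pphi hab]] pb sb.
pose l := take p b; pose v := drop p b.
have eb : b = l ++ v by rewrite cat_take_drop.
have sl : size l = p by rewrite size_takel.
pose t := (phi, (l, size a %% m)).
have ht : exists u v, P t u v.
  by exists a, v; split; rewrite /= ?modn_mod // -eb.
have [v' [su' hu']] := hf t ht; rewrite /= modn_mod in su'.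
exists (f t).
  have : [set` cs] (f t); last by [].
  by rewrite -hcs; exists t => //=; rewrite ltn_mod.
exists phi => //; rewrite eb.
apply: (comps_exchange sl su' (v := v')) hu' _; by rewrite -eb.
Qed.

Hypothesis simPhi : forall phi psi, Phi phi -> Phi psi -> Defs.similar phi psi.
Hypothesis afPhi : exists2 psi, Phi psi & asymptotically_free psi.

(** The bounds of [comps_dichotomy] are merged over the finitely many types. Either some function in
    [Phi] admits all large [x], and so does the union, or all of them reject all large [x]. The
    length [p + p] leaves [p] parts as a margin outside the [p] parts that touch the cut. *)
Lemma class_dichotomy K : exists M, forall a b : seq nat,
  p + p <= size a -> p + p <= size b ->
  small K (drop (size a - p) a) -> small K (take p b) ->
  (forall x, M <= x -> C (a ++ x :: b)) \/
  (forall x, M <= x -> ~ C (a ++ x :: b)).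
Proof.
have [psi Ppsi afpsi] := afPhi.
pose small_seqs := [set l : seq nat | size l = p /\ small K l].
pose T := ((restriction m p * (seq nat * nat)) * seq nat)%type.
pose P (t : T) M := forall u v,
  p <= size u -> p <= size v -> size u = t.1.2.2 %[mod m] ->
  let c x := u ++ (t.1.2.1 ++ x :: t.2) ++ v in
  (forall x, M <= x -> comps t.1.1 (c x)) \/
  (forall x, M <= x -> ~ comps t.1.1 (c x)).
have [|||M hM] := @finite_uniform_bound T
  ((Phi `*` (small_seqs `*` `I_m)) `*` small_seqs) P.
- by apply: finite_setX; [exact: finite_types|exact: finite_small].
- move=> t M M' MM' h u v pu pv su.
  have [hl|hr] := h u v pu pv su; [left|right] => x /(leq_trans MM').
    exact: hl.
  exact: hr.
- move=> [[phi [l j]] q] [[/= Pphi [[sl _] _]] [sq _]].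
  exact: (comps_dichotomy m_gt0 _ (simPhi Pphi Ppsi) afpsi sl sq).
exists M => a b pa pb sa sb.
pose u := take (size a - p) a; pose l := drop (size a - p) a.
have ea : a = u ++ l by rewrite cat_take_drop.
have sl : size l = p by rewrite size_drop subKn //; lia.
pose q := take p b; pose v := drop p b.
have eb : b = q ++ v by rewrite cat_take_drop.
have sq : size q = p by rewrite size_takel //; lia.
have pu : p <= size u by rewrite size_takel; lia.
have pv : p <= size v by rewrite size_drop; lia.
have dich phi : Phi phi ->
    (forall x, M <= x -> comps phi (a ++ x :: b)) \/
    (forall x, M <= x -> ~ comps phi (a ++ x :: b)).
  move=> Pphi; pose t : T := ((phi, (l, size u %% m)), q).
  have := hM t _ u v pu pv; rewrite /= modn_mod.
  have e x : u ++ (l ++ x :: q) ++ v = a ++ x :: b by rewrite ea eb -!catA.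
  move=> h; have [||hl|hr] := h _ _.
  - by split=> //=; split=> //=; split=> //=; rewrite ltn_mod.
  - by [].
  - by left=> x; rewrite -e; apply: hl.
  - by right=> x; rewrite -e; apply: hr.
have [[phi [Pphi hphi]]|no] := pselect (exists phi, Phi phi /\
    forall x, M <= x -> comps phi (a ++ x :: b)).
  by left=> x Mx; exists phi => //; apply: hphi.
right=> x Mx [phi Pphi hx]; have [hl|hr] := dich _ Pphi.
  by apply: no; exists phi.
exact: hr hx.
Qed.

Lemma composition_prefixes : prefixes C `<=` [set a | composition a].
Proof.
by move=> a [b [phi _ [+ _]]]; rewrite /composition all_cat /= => /andP[].
Qed.

Lemma composition_suffixes : suffixes C `<=` [set b | composition b].
Proof.
by move=> b [a [phi _ [+ _]]]; rewrite /composition all_cat /= => /andP[].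
Qed.

(** Beyond the bound of [class_dichotomy], membership for one [k] amounts to membership for
    infinitely many [x], to which the freeness hypothesis applies. *)
Lemma class_cut l K :
  (forall a b, composition a -> composition b -> l <= size a -> l <= size b ->
    (infinite_set [set x | 0 < x /\ C (a ++ x :: b)] <-> C a /\ C b)) ->
  exists M, forall a b k, prefixes C a -> suffixes C b ->
    maxn l (p + p) <= size a -> maxn l (p + p) <= size b ->
    small K (drop (size a - p) a) -> small K (take p b) -> M <= k ->
    C (a ++ k :: b) <-> C a /\ C b.
Proof.
move=> free; have [M hM] := class_dichotomy K; exists M => a b k.
move=> /composition_prefixes ca /composition_suffixes cb.
rewrite !geq_max => /andP[la pa] /andP[lb pb] sa sb Mk.
rewrite -(free a b) //; have [hl|hr] := hM a b pa pb sa sb; split=> //.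
- move=> _ fin; apply: infinite_nat.
  have [s hs] := (finite_seqP _).1 fin.
  have : (M + (\max_(x <- s) x)).+1 \in s.
    have : [set` s] (M + (\max_(x <- s) x)).+1; last by [].
    by rewrite -hs; split=> //; apply: hl; lia.
  by move=> /(leq_bigmax_seq (F := id)) => /(_ xpredT isT) /=; lia.
- by move=> _; apply: hl.
- by move=> h; case: (hr k Mk h).
- move=> inf; exfalso; apply: inf; apply: sub_finite_set (finite_II M) => x [_ hx] /=.
  by rewrite ltnNge; apply/negP => /hr.
Qed.

End Classes.

(** * Counting words and pairs of words *)

Section Counting.
Local Open Scope nat_scope.

Definition words (n : nat) : {fset seq nat} :=
  fset_set (comps_of [set c | composition c] n).

Lemma composition_cat a b : composition (a ++ b) = composition a && composition b.
Proof. exact: all_cat. Qed.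

Lemma mem_words n c : (c \in words n) = composition c && (sumn c == n).
Proof.
rewrite /words in_fset_set; last exact: finite_comps_of.
by apply/idP/idP => [|/andP[h /eqP <-]]; rewrite inE // => -[/= -> ->]; rewrite eqxx.
Qed.

Definition pairs (n : nat) : seq (seq nat * seq nat) :=
  [seq ab | i <- iota 0 n.+1,
            ab <- [seq (a, b) | a <- words i, b <- words (n - i)]].

Lemma mem_pairs n a b : ((a, b) \in pairs n) =
  [&& composition a, composition b & sumn a + sumn b == n].
Proof.
apply/allpairsPdep/and3P => [[i [ab []]]|[ca cb /eqP <-]].
  rewrite mem_iota => hi /allpairsPdep[a' [b' []]].
  rewrite !mem_words => /andP[ca /eqP sa] /andP[cb /eqP sb] -> [-> ->].
  by split=> //; rewrite sa sb subnKC.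
exists (sumn a), (a, b); split=> //; first by rewrite mem_iota; lia.
apply/allpairsPdep; exists a, b.
by rewrite !mem_words ca cb eqxx addKn eqxx.
Qed.

Lemma uniq_allpairs_key (S U : eqType) (key : U -> S) (s : seq S) (t : S -> seq U) :
  uniq s -> {in s, forall x, uniq (t x)} ->
  (forall x y, x \in s -> y \in t x -> key y = x) ->
  uniq [seq y | x <- s, y <- t x].
Proof.
move=> us ut hk; apply: allpairs_uniq_dep => // -[x y] [x' y'].
move=> /allpairsPdep[x1 [y1 [xs yt [-> ->]]]].
move=> /allpairsPdep[x2 [y2 [xs2 yt2 [-> ->]]]] /= e.
by rewrite -(hk _ _ xs yt) -(hk _ _ xs2 yt2) e.
Qed.

Lemma uniq_pairs n : uniq (pairs n).
Proof.
apply: (@uniq_allpairs_key _ _ (fun ab => sumn ab.1)) => [|i _|i ab _].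
- exact: iota_uniq.
- by apply: allpairs_uniq; rewrite ?fset_uniq // => -[? ?] [? ?] _ _ /= [-> ->].
- case/allpairsPdep => [a [b []]].
  by rewrite !mem_words => /andP[_ /eqP sa] _ ->.
Qed.

(** The common source of the counting inequalities: a map from the items counted on the right onto
    those counted on the left. *)
Lemma count_le_surj (T U : eqType) (f : U -> T) (s : seq T) (s' : seq U)
    (P : pred T) (Q : pred U) : uniq s ->
  (forall x, x \in s -> P x -> exists y, [/\ y \in s', Q y & f y = x]) ->
  count P s <= count Q s'.
Proof.
move=> us h; rewrite -!size_filter -(size_map f).
apply: uniq_leq_size => [|x]; first exact: filter_uniq.
rewrite mem_filter => /andP[Px xs]; have [y [ys' Qy <-]] := h x xs Px.
by rewrite map_f // mem_filter Qy.
Qed.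

Definition convol (x y : nat -> nat) n := \sum_(i < n.+1) x i * y (n - i).

Lemma convolC x y n : convol x y n = convol y x n.
Proof.
rewrite /convol (reindex_inj rev_ord_inj) /=; apply: eq_bigr => i _.
by rewrite subSS mulnC subKn // -ltnS.
Qed.

Implicit Types (X Y Z C : set (seq nat)) (T : set (seq nat * seq nat)).

Definition cnt X n := count (fun c => `[<X c>]) (words n).
Definition cnt_pairs T n := count (fun ab => `[<T ab>]) (pairs n).

Lemma num_comps_cnt C n : C `<=` [set c | composition c] -> num_comps C n = cnt C n.
Proof.
move=> CC; rewrite /num_comps /cnt -size_filter; apply/perm_size/uniq_perm.
- exact: fset_uniq.
- exact/filter_uniq/fset_uniq.
move=> c; rewrite mem_filter mem_words in_fset_set; last exact: finite_comps_of.
apply/idP/and3P => [|[/asboolP Cc _ /eqP sc]]; last by rewrite inE.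
by rewrite inE => -[Cc ->]; split=> //; [exact/asboolP|exact: CC].
Qed.

Lemma leq_cnt X Y n : (forall c, composition c -> X c -> Y c) -> cnt X n <= cnt Y n.
Proof.
move=> XY; rewrite /cnt; apply: (@count_le_surj _ _ id); first exact: fset_uniq.
move=> c cn /asboolP Xc; exists c; split=> //; apply/asboolP; apply: XY => //.
by move: cn; rewrite mem_words => /andP[].
Qed.

Lemma cntU X Y n : cnt (X `|` Y) n <= cnt X n + cnt Y n.
Proof.
rewrite /cnt -count_predUI; apply: leq_trans (leq_addr _ _).
by apply: sub_count => c /asboolP[h|h]; apply/orP; [left|right]; apply/asboolP.
Qed.

Lemma leq_cnt_pairs T T' n :
  (forall a b, composition a -> composition b -> T (a, b) -> T' (a, b)) ->
  cnt_pairs T n <= cnt_pairs T' n.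
Proof.
move=> TT; rewrite /cnt_pairs; apply: (@count_le_surj _ _ id).
  exact: uniq_pairs.
move=> [a b] abn /asboolP Xc; exists (a, b); split=> //; apply/asboolP; apply: TT => //;
by move: abn; rewrite mem_pairs => /and3P[].
Qed.

Lemma cnt_pairsU T T' n : cnt_pairs (T `|` T') n <= cnt_pairs T n + cnt_pairs T' n.
Proof.
rewrite /cnt_pairs -count_predUI; apply: leq_trans (leq_addr _ _).
by apply: sub_count => c /asboolP[h|h]; apply/orP; [left|right]; apply/asboolP.
Qed.

Lemma cnt_pairsX X Y n : cnt_pairs (X `*` Y) n = convol (cnt X) (cnt Y) n.
Proof.
rewrite /cnt_pairs /pairs -sum1_count big_mkcond big_allpairs_dep.
rewrite /convol /cnt -(big_mkord xpredT (fun i => count (fun c => `[<X c>]) (words i) *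
  count (fun c => `[<Y c>]) (words (n - i)))) /index_iota subn0.
apply: eq_bigr => i _; rewrite big_allpairs_dep /= -!sum1_count big_distrlr /=.
rewrite [RHS]big_mkcond /=; apply: eq_bigr => a _.
case: asboolP => Xa /=.
  rewrite [RHS]big_mkcond; apply: eq_bigr => b _ /=.
  by congr (if _ then _ else _); apply: asbool_equiv_eq; split=> // -[].
rewrite big1 // => b _; case: asboolP => // -[]; by [].
Qed.

Definition concat X Y : set (seq nat) :=
  [set c | exists a b, [/\ c = a ++ b, X a & Y b]].

(** Only an inequality, since a word may split in several ways. *)
Lemma cnt_concat X Y n : cnt (concat X Y) n <= convol (cnt X) (cnt Y) n.
Proof.
rewrite -cnt_pairsX; apply: (@count_le_surj _ _ (fun ab => ab.1 ++ ab.2)).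
  exact: fset_uniq.
move=> c + /asboolP[a [b [ec Xa Yb]]]; rewrite mem_words ec composition_cat sumn_cat.
move=> /andP[/andP[ca cb] sn]; exists (a, b); split=> //; last exact/asboolP.
by rewrite mem_pairs; apply/and3P.
Qed.

Lemma cnt_extend_right X b n : composition b ->
  cnt [set a | X (a ++ b)] n <= cnt X (n + sumn b).
Proof.
move=> cb; apply: (@count_le_surj _ _ (fun c => take (size c - size b) c)).
  exact: fset_uniq.
move=> a + /asboolP Xab; rewrite mem_words => /andP[ca /eqP sa].
exists (a ++ b); split; last by rewrite size_cat addnK take_size_cat.
  by rewrite mem_words composition_cat ca cb sumn_cat sa eqxx.
exact/asboolP.
Qed.

Lemma cnt_extend_left X a n : composition a ->
  cnt [set b | X (a ++ b)] n <= cnt X (n + sumn a).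
Proof.
move=> ca; apply: (@count_le_surj _ _ (drop (size a))).
  exact: fset_uniq.
move=> b + /asboolP Xab; rewrite mem_words => /andP[cb /eqP sb].
exists (a ++ b); split; last by rewrite drop_size_cat.
  by rewrite mem_words composition_cat ca cb sumn_cat sb addnC eqxx.
exact/asboolP.
Qed.

(** Double counting: a word with one marked part equal to [k] is the same thing as the pair of words
    on either side of the mark. *)
Lemma sum_count_mem C k n : 0 < k -> k <= n ->
  \sum_(c <- words n | `[<C c>]) count_mem k c =
  cnt_pairs [set ab | C (ab.1 ++ k :: ab.2)] (n - k).
Proof.
move=> k0 kn.
(* Words of the class with a marked position, which here is 0-based. *)
pose L := [seq ct | c <- [seq c <- words n | `[<C c>]],
                    ct <- [seq (c, t) | t <- iota 0 (size c)]].
have memL c t : ((c, t) \in L) =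
    [&& `[<C c>], composition c, sumn c == n & t < size c].
  apply/allpairsPdep/and4P => [[c' [ct []]]|[Cc cc sc tc]].
    rewrite mem_filter mem_words => /and3P[Cc cc sc] /mapP[t'].
    by rewrite mem_iota => /andP[_ tc] -> [-> ->].
  exists c, (c, t); split=> //; first by rewrite mem_filter mem_words Cc cc.
  by rewrite map_f // mem_iota.
have uL : uniq L.
  apply: (@uniq_allpairs_key _ _ fst) => [|c _|c ct _ /mapP[t _ ->] //].
    exact/filter_uniq/fset_uniq.
  by rewrite map_inj_uniq ?iota_uniq // => t t' [].
pose Q (ct : seq nat * nat) := nth 0 ct.1 ct.2 == k.
have -> : \sum_(c <- words n | `[<C c>]) count_mem k c = count Q L.
  rewrite /L -[RHS]sum1_count [RHS]big_mkcond big_allpairs_dep /= big_filter.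
  apply: eq_bigr => c _; rewrite big_map -big_mkcond sum1_count.
  by rewrite -[in LHS](take_size c) -(map_nth_iota0 0 (leqnn (size c))) count_map.
have split_at c t : t < size c -> nth 0 c t = k -> take t c ++ k :: drop t.+1 c = c.
  by move=> tc <-; rewrite -drop_nth // cat_take_drop.
apply/eqP; rewrite eqn_leq; apply/andP; split.
  apply: (@count_le_surj _ _ (fun ab : seq nat * seq nat =>
    (ab.1 ++ k :: ab.2, size ab.1))) => //.
  move=> [c t]; rewrite memL => /and4P[/asboolP Cc cc /eqP sc tc] /eqP /= ct.
  have e := split_at _ _ tc ct; exists (take t c, drop t.+1 c); split => /=.
  - rewrite -e composition_cat /= in cc; have /and3P[c1 _ c2] := cc.
    rewrite mem_pairs c1 c2 /=; apply/eqP.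
    by rewrite -e sumn_cat /= in sc; rewrite -sc; lia.
  - by apply/asboolP; rewrite /= e.
  - by rewrite e size_takel // ltnW.
apply: (@count_le_surj _ _ (fun ct : seq nat * nat =>
  (take ct.2 ct.1, drop ct.2.+1 ct.1))).
  exact: uniq_pairs.
move=> [a b]; rewrite mem_pairs => /and3P[ca cb /eqP sab] /asboolP /= Cab.
exists (a ++ k :: b, size a); split=> /=.
- rewrite memL; apply/and4P; split; first exact/asboolP.
  + by rewrite composition_cat /= k0; apply/andP.
  + by rewrite sumn_cat /=; apply/eqP; lia.
  + by rewrite size_cat /=; lia.
- by rewrite /Q /= nth_cat ltnn subnn.
- by rewrite take_size_cat // -cat_rcons drop_size_cat ?size_rcons.
Qed.

End Counting.

(** * Generating functions at the radius of convergence *)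

Section Weights.
Variables (R : realType) (r : R).
Hypotheses (r_gt0 : 0 < r) (r_lt1 : r < 1).
Implicit Types (X Y Z C : set (seq nat)) (D G : R) (x y : nat -> nat).

(** That [x n] is O(r^-n), with an explicit constant to carry through recursions. *)
Definition wbounded D x := forall n, (x n)%:R * r ^+ n <= D.
(** The generating function of [x] is at most [G] at [r]; the terms being nonnegative, partial sums
    suffice and no infinite sum is needed. *)
Definition wsummable G x := forall N, \sum_(i < N) (x i)%:R * r ^+ i <= G.

Let rn_ge0 n : 0 <= r ^+ n.
Proof. by rewrite exprn_ge0 // ltW. Qed.

Lemma weight_ge0 x n : 0 <= (x n)%:R * r ^+ n.
Proof. by rewrite mulr_ge0 // exprn_ge0 // ltW. Qed.

Lemma wbounded_ge0 D x : wbounded D x -> 0 <= D.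
Proof. by move=> /(_ 0%N); apply: le_trans; exact: weight_ge0. Qed.

Lemma wsummable_ge0 G x : wsummable G x -> 0 <= G.
Proof. by move=> /(_ 0%N); rewrite big_ord0. Qed.

Lemma wsummable_wbounded G x : wsummable G x -> wbounded G x.
Proof.
move=> h n; apply: le_trans (h n.+1); rewrite big_ord_recr /= lerDr.
by apply: sumr_ge0 => i _; exact: weight_ge0.
Qed.

Lemma convol_weight x y n : (convol x y n)%:R * r ^+ n =
  \sum_(i < n.+1) ((x i)%:R * r ^+ i) * ((y (n - i)%N)%:R * r ^+ (n - i)).
Proof.
rewrite /convol natr_sum mulr_suml; apply: eq_bigr => i _.
by rewrite mulrACA -natrM -exprD subnKC // -ltnS.
Qed.

Lemma wbounded_convol D G x y :
  wbounded D x -> wsummable G y -> wbounded (D * G) (convol x y).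
Proof.
move=> hx hy n; rewrite convol_weight.
apply: le_trans (_ : D * (\sum_(i < n.+1) (y i)%:R * r ^+ i) <= _); last first.
  by rewrite ler_wpM2l ?(wbounded_ge0 hx).
rewrite mulr_sumr [leRHS](reindex_inj rev_ord_inj) /=.
by apply: ler_sum => i _; rewrite subSS ler_wpM2r ?weight_ge0.
Qed.

(** With neither factor summable a factor [n.+1] is lost; this is where the linear growth in the
    estimate of bad pairs comes from. *)
Lemma convol_wbounded D D' x y n : wbounded D x -> wbounded D' y ->
  (convol x y n)%:R * r ^+ n <= n.+1%:R * (D * D').
Proof.
move=> hx hy; rewrite convol_weight mulr_natl.
rewrite -[X in _ *+ X](card_ord n.+1) -sumr_const; apply: ler_sum => i _.
by rewrite ler_pM ?weight_ge0.
Qed.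

Lemma wsummable_convol G G' x y :
  wsummable G x -> wsummable G' y -> wsummable (G * G') (convol x y).
Proof.
move=> hx hy N; under eq_bigr do rewrite convol_weight.
pose f i := (x i)%:R * r ^+ i; pose g i := (y i)%:R * r ^+ i.
have g0 i : 0 <= g i by exact: weight_ge0.
have f0 i : 0 <= f i by exact: weight_ge0.
apply: le_trans (_ : (\sum_(i < N) f i) * G' <= _); last first.
  by rewrite ler_wpM2r ?(wsummable_ge0 hy) //; apply: hx.
(* The triangle of indices is summed in the other order, so that each [f j] multiplies a partial sum
   of [g]. *)
have -> : \sum_(i < N) \sum_(j < i.+1) f j * g (i - j)%N =
    \sum_(0 <= j < N) \sum_(j <= i < N) f j * g (i - j)%N.
  transitivity (\sum_(0 <= i < N) \sum_(0 <= j < N | (j < i.+1)%N) f j * g (i - j)%N).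
    rewrite big_mkord; apply: eq_bigr => i _.
    by rewrite -(big_mkord xpredT (fun j => f j * g (i - j)%N))
      (big_nat_widen 0 i.+1 N).
  rewrite (exchange_big_dep_nat xpredT) //=; apply: eq_bigr => j _.
  by rewrite [RHS](big_nat_widenl j 0).
rewrite mulr_suml -(big_mkord xpredT (fun j => f j * G')).
apply: ler_sum => j _; rewrite -mulr_sumr ler_wpM2l //.
rewrite -[X in \sum_(X <= _ < _) _]add0n big_addn.
under eq_bigr do rewrite addnK.
rewrite big_mkord; apply: le_trans (hy (N - j)%N).
exact: lexx.
Qed.

(** Strong induction: if the earlier terms are at most [2 * D], the convolution adds at most half of
    this, and [y] adds [D]. Since [b] vanishes at 0, the convolution involves earlier terms only. *)
Lemma wbounded_rec D x y b :
  (forall n, x n <= y n + convol x b n)%N -> b 0%N = 0%N ->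
  wbounded D y -> wsummable 2^-1 b -> wbounded (2 * D) x.
Proof.
move=> hx b0 hy hb n; elim/ltn_ind: n => n IH.
have D0 := wbounded_ge0 hy.
apply: le_trans (_ : (y n + convol x b n)%N%:R * r ^+ n <= _).
  by rewrite ler_wpM2r ?rn_ge0 // ler_nat.
rewrite natrD mulrDl [leRHS]mulr_natl mulr2n lerD //.
rewrite convol_weight big_ord_recr /= subnn b0 mul0r mulr0 addr0.
apply: le_trans (_ : 2 * D * 2^-1 <= _); last by rewrite mulrAC divff // mul1r.
apply: le_trans (_ : 2 * D * (\sum_(i < n.+1) (b i)%:R * r ^+ i) <= _); last first.
  by rewrite ler_wpM2l // mulr_ge0.
rewrite [X in _ <= _ * X](reindex_inj rev_ord_inj) /= big_ord_recr /= mulrDr.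
rewrite mulr_sumr ler_wpDr ?mulr_ge0 ?weight_ge0 //.
by apply: ler_sum => i _; rewrite subSS ler_wpM2r ?weight_ge0 // IH.
Qed.

Definition large (K : nat) : set (seq nat) :=
  [set c | exists2 x, (K < x)%N & c = [:: x]].
Definition short (L : nat) : set (seq nat) := [set c | (size c < L)%N].

Lemma cnt_large K n : (cnt (large K) n <= (K < n))%N.
Proof.
case: (ltnP K n) => hK; last first.
  rewrite leqn0 /cnt -(size_filter _ (words n)) size_eq0 -(negbK (_ == _)) -has_filter.
  apply/hasPn => c; rewrite mem_words => /andP[_ /eqP sc].
  by apply/asboolP => -[x Kx ec]; move: sc; rewrite ec /=; lia.
apply: (@count_le_surj _ _ (fun=> [:: n]) _ [:: tt] _ predT).
  exact: fset_uniq.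
move=> c; rewrite mem_words => /andP[_ /eqP sc] /asboolP[x _ ec].
by exists tt; split=> //; move: sc; rewrite ec /= addn0 => ->.
Qed.

Lemma wsummable_large K : wsummable (r ^+ K.+1 / (1 - r)) (cnt (large K)).
Proof.
have r1 : 0 < 1 - r by rewrite subr_gt0.
move=> N; rewrite ler_pdivlMr //.
(* A telescoping invariant for the induction on [N]; the [maxn] keeps it at 0 until [N] exceeds
   [K.+1]. *)
apply: le_trans (_ : r ^+ K.+1 - r ^+ maxn N K.+1 <= _); last first.
  by rewrite gerBl exprn_ge0 // ltW.
elim: N => [|N IH]; first by rewrite big_ord0 mul0r max0n subrr.
rewrite big_ord_recr /= mulrDl.
have := cnt_large K N; case: ltnP => KN; last first.
  rewrite leqn0 => /eqP ->; rewrite !mul0r addr0 (le_trans IH) //.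
  by rewrite (maxn_idPr _) ?subrr ?(maxn_idPr _) ?subrr //; lia.
rewrite (maxn_idPl _) in IH; last by lia.
rewrite (maxn_idPl _); last by lia.
move=> c1; apply: le_trans (lerD IH (_ : _ <= r ^+ N - r ^+ N.+1)) _; last first.
  by rewrite addrA subrK.
rewrite exprSr -{2}[r ^+ N]mulr1 -mulrBr ler_wpM2r ?(ltW r1) // ler_piMl ?rn_ge0 //.
by rewrite lern1.
Qed.

(** Induction on [L], splitting off the first part; [large 0] is the set of compositions with
    exactly one part. *)
Lemma wsummable_short L : exists G, wsummable G (cnt (short L)).
Proof.
elim: L => [|L [G hG]].
  exists 0 => N; rewrite big1 // => i _.
  suff -> : cnt (short 0) i = 0%N by rewrite mul0r.
  by apply/eqP; rewrite -leqn0 leqNgt -has_count; apply/hasPn => c _; apply/asboolP.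
exists (1 + r ^+ 1 / (1 - r) * G) => N.
have step i : (cnt (short L.+1) i <=
    (i == 0) + convol (cnt (large 0)) (cnt (short L)) i)%N.
  apply: leq_trans (leq_trans (cntU [set [::]] (concat (large 0) (short L)) i) _).
    apply: leq_cnt => -[|x c]; first by left.
    by move=> /andP[x0 _] /= sc; right; exists [:: x], c; split=> //; exists x.
  rewrite leq_add ?cnt_concat //.
  have [->|i0] := eqVneq i 0%N.
    apply: (@count_le_surj _ _ (fun=> [::]) _ [:: tt] _ predT).
      exact: fset_uniq.
    by move=> c _ /asboolP ->; exists tt.
  rewrite leqn0 -leqn0 leqNgt -has_count; apply/hasPn => c.
  rewrite mem_words => /andP[_ /eqP sc]; apply/asboolP => ec.
  by move: i0; rewrite -sc ec.
apply: le_trans (_ : \sum_(i < N) ((i == 0%N :> nat)%:R * r ^+ i +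
    (convol (cnt (large 0)) (cnt (short L)) i)%:R * r ^+ i) <= _).
  apply: ler_sum => i _; rewrite -mulrDl -natrD ler_wpM2r ?rn_ge0 //.
  by rewrite ler_nat.
rewrite big_split lerD //=; last exact: wsummable_convol (wsummable_large 0) hG N.
case: N => [|N]; first by rewrite big_ord0.
by rewrite big_ord_recl /= expr0 mulr1 big1 ?addr0 // => i _; rewrite mul0r.
Qed.

Lemma le_wbounded D x y : (forall n, x n <= y n)%N -> wbounded D y -> wbounded D x.
Proof.
move=> xy hy n; apply: le_trans (hy n).
by rewrite ler_wpM2r ?rn_ge0 // ler_nat.
Qed.

Lemma le_wsummable G x y : (forall n, x n <= y n)%N -> wsummable G y -> wsummable G x.
Proof.
move=> xy hy n; apply: le_trans (hy n); apply: ler_sum => i _.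
by rewrite ler_wpM2r ?rn_ge0 // ler_nat.
Qed.

End Weights.

(** * Bounds for prefixes, suffixes and bad cuts *)

Section ClassBounds.
Variables (R : realType) (r : R).
Hypotheses (r_gt0 : 0 < r) (r_lt1 : r < 1).
Variables (C : set (seq nat)) (p : nat).
Hypotheses (p_gt0 : (0 < p)%N) (CC : C `<=` [set c | composition c]).
Variable D : R.
Hypothesis C_bounded : wbounded r D (cnt C).

Lemma exists_geometric_le (c e : R) : 0 <= c -> 0 < e -> exists K, c * r ^+ K <= e.
Proof.
move=> c0 e0; have c1 : 0 < c + 1 by rewrite ltr_wpDl.
have : r ^+ n @[n --> \oo] --> (0 : R).
  by apply: cvg_expr; rewrite ger0_norm // ltW.
move=> /cvgrPdist_le /(_ (e / (c + 1)) (divr_gt0 e0 c1)) [K _ /(_ K (leqnn K))] /=.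
rewrite sub0r normrN ger0_norm ?exprn_ge0 ?(ltW r_gt0) // ler_pdivlMr // => h.
exists K; apply: le_trans h; rewrite mulrC ler_wpM2l ?exprn_ge0 ?(ltW r_gt0) //.
by rewrite lerDl.
Qed.

Lemma not_small_cat K c : ~~ small K c ->
  exists u x v, c = u ++ [:: x] ++ v /\ (K < x)%N.
Proof.
rewrite /small -has_predC => /hasP[x /splitPr[u v]] /=; rewrite -ltnNge => Kx.
by exists u, x, v.
Qed.

Lemma cntU_wbounded D1 D2 X Y : wbounded r D1 (cnt X) -> wbounded r D2 (cnt Y) ->
  wbounded r (D1 + D2) (cnt (X `|` Y)).
Proof.
move=> h1 h2 n; apply: le_trans (lerD (h1 n) (h2 n)).
by rewrite -mulrDl -natrD ler_wpM2r ?exprn_ge0 ?(ltW r_gt0) // ler_nat cntU.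
Qed.

(** Appending a fixed [b] is injective into [C] and raises the weight by [sumn b], which costs a
    factor [r ^- sumn b]; the bounds are added over the list. *)
Lemma cnt_extend_right_wbounded (bs : seq (seq nat)) : exists D',
  wbounded r D' (cnt [set a | exists2 b, b \in bs & C (a ++ b)]).
Proof.
elim: bs => [|b bs [D' hD']].
  exists D => n; apply: le_trans (C_bounded n).
  by rewrite ler_wpM2r ?exprn_ge0 ?(ltW r_gt0) // ler_nat leq_cnt // => c _ [].
have [cb|ncb] := boolP (composition b); last first.
  exists D'; apply: le_wbounded hD' => // n; apply: leq_cnt => a ca [b'].
  rewrite inE => /orP[/eqP ->|b'bs] Cab; last by exists b'.
  by have := CC Cab; rewrite /= composition_cat (negbTE ncb) andbF.
exists (D / r ^+ sumn b + D') => n.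
apply: le_trans (@cntU_wbounded _ _ [set a | C (a ++ b)] _ _ hD' n).
  rewrite ler_wpM2r ?exprn_ge0 ?(ltW r_gt0) // ler_nat leq_cnt // => a _ [b'].
  by rewrite inE => /orP[/eqP ->|b'bs] Cab; [left|right; exists b'].
move=> k; rewrite ler_pdivlMr ?exprn_gt0 // -mulrA -exprD.
apply: le_trans (C_bounded (k + sumn b)).
by rewrite ler_wpM2r ?exprn_ge0 ?(ltW r_gt0) // ler_nat cnt_extend_right.
Qed.

Lemma cnt_extend_left_wbounded (bs : seq (seq nat)) : exists D',
  wbounded r D' (cnt [set a | exists2 b, b \in bs & C (b ++ a)]).
Proof.
elim: bs => [|b bs [D' hD']].
  exists D => n; apply: le_trans (C_bounded n).
  by rewrite ler_wpM2r ?exprn_ge0 ?(ltW r_gt0) // ler_nat leq_cnt // => c _ [].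
have [cb|ncb] := boolP (composition b); last first.
  exists D'; apply: le_wbounded hD' => // n; apply: leq_cnt => a ca [b'].
  rewrite inE => /orP[/eqP ->|b'bs] Cab; last by exists b'.
  by have := CC Cab; rewrite /= composition_cat (negbTE ncb).
exists (D / r ^+ sumn b + D') => n.
apply: le_trans (@cntU_wbounded _ _ [set a | C (b ++ a)] _ _ hD' n).
  rewrite ler_wpM2r ?exprn_ge0 ?(ltW r_gt0) // ler_nat leq_cnt // => a _ [b'].
  by rewrite inE => /orP[/eqP ->|b'bs] Cab; [left|right; exists b'].
move=> k; rewrite ler_pdivlMr ?exprn_gt0 // -mulrA -exprD.
apply: le_trans (C_bounded (k + sumn b)).
by rewrite ler_wpM2r ?exprn_ge0 ?(ltW r_gt0) // ler_nat cnt_extend_left.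
Qed.

Definition blocks K : set (seq nat) := [set c | size c = p /\ ~~ small K c].

Lemma cnt_blocks0 K : cnt (blocks K) 0 = 0%N.
Proof.
apply/eqP; rewrite -leqn0 leqNgt -has_count; apply/hasPn => c.
rewrite mem_words => /andP[cc /eqP sc]; apply/asboolP => -[sp _].
move: cc sc; case: c sp => [|x c] /= sp; first by move: p_gt0; rewrite -sp.
by rewrite /composition /= => /andP[]; lia.
Qed.

(** Around a part exceeding [K] a block splits as short, large, short, so its generating function at
    [r] is at most a constant times [r ^+ K]. *)
Lemma wsummable_blocks : exists K, wsummable r 2^-1 (cnt (blocks K)).
Proof.
have [G hG] := wsummable_short r_gt0 r_lt1 p.
have G0 := wsummable_ge0 hG.
have r1 : 0 < 1 - r by rewrite subr_gt0.
have [||K hK] := @exists_geometric_le (G * G * (r / (1 - r))) 2^-1.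
- by rewrite !mulr_ge0 // ?invr_ge0 ltW.
- by rewrite invr_gt0.
exists K => N; apply: le_trans hK.
have hL := wsummable_large r_gt0 r_lt1 K.
have := wsummable_convol r_gt0 hG (wsummable_convol r_gt0 hL hG).
have -> : G * (r ^+ K.+1 / (1 - r) * G) = G * G * (r / (1 - r)) * r ^+ K.
  by rewrite exprS; ring.
move=> h; apply: (le_wsummable r_gt0 _ h) => n.
apply: leq_trans (leq_trans (cnt_concat (short p) (concat (large K) (short p)) n) _).
  apply: leq_cnt => c cc [sp /not_small_cat[u [x [v [ec Kx]]]]].
  have := congr1 size ec; rewrite sp !size_cat /= => sp'.
  exists u, ([:: x] ++ v); split=> //; first by rewrite /short /=; lia.
  exists [:: x], v; split=> //; first by exists x.
  by rewrite /short /=; lia.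
by apply: leq_sum => i _; rewrite leq_mul // cnt_concat.
Qed.

Hypothesis pre_completions : forall K, exists bs : seq (seq nat), forall a,
  prefixes C a -> (p <= size a)%N -> small K (drop (size a - p) a) ->
  exists2 b, b \in bs & C (a ++ b).
Hypothesis suf_completions : forall K, exists cs : seq (seq nat), forall b,
  suffixes C b -> (p <= size b)%N -> small K (take p b) ->
  exists2 a, a \in cs & C (a ++ b).

(** An instance of [wbounded_rec]. Short prefixes and those completed by a word of [bs] form the
    bounded term; in the remaining case, removing the last [p] parts leaves a prefix again, which
    gives the recursive term. *)
Lemma prefixes_wbounded : exists D', wbounded r D' (cnt (prefixes C)).
Proof.
have [K hK] := wsummable_blocks; have [bs hbs] := pre_completions K.
have [G hG] := wsummable_short r_gt0 r_lt1 p.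
have [D' hD'] := cnt_extend_right_wbounded bs.
eexists; apply: (wbounded_rec r_gt0 _ (cnt_blocks0 K)
  (cntU_wbounded (wsummable_wbounded r_gt0 hG) hD') hK) => n.
apply: leq_trans (leq_trans (cntU _ _ _) (leq_add (leqnn _) (cnt_concat _ _ _))).
apply: leq_cnt => a ca pa; have [sp|ps] := ltnP (size a) p; first by left; left.
have [sa|nsa] := boolP (small K (drop (size a - p) a)).
  by left; right; have [b bbs hb] := hbs a pa ps sa; exists b.
right; exists (take (size a - p) a), (drop (size a - p) a); split.
- by rewrite cat_take_drop.
- by have [b hb] := pa; exists (drop (size a - p) a ++ b); rewrite catA cat_take_drop.
- by split=> //; rewrite size_drop subKn.
Qed.

Lemma suffixes_wbounded : exists D', wbounded r D' (cnt (suffixes C)).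
Proof.
have [K hK] := wsummable_blocks; have [cs hcs] := suf_completions K.
have [G hG] := wsummable_short r_gt0 r_lt1 p.
have [D' hD'] := cnt_extend_left_wbounded cs.
eexists; apply: (wbounded_rec r_gt0 _ (cnt_blocks0 K)
  (cntU_wbounded (wsummable_wbounded r_gt0 hG) hD') hK) => n.
(* For suffixes the block is removed at the front, so the factors trade places. *)
rewrite convolC.
apply: leq_trans (leq_trans (cntU _ _ _) (leq_add (leqnn _) (cnt_concat _ _ _))).
apply: leq_cnt => b cb sb; have [sp|ps] := ltnP (size b) p; first by left; left.
have [small_b|nsb] := boolP (small K (take p b)).
  by left; right; have [a acs ha] := hcs b sb ps small_b; exists a.
right; exists (take p b), (drop p b); split.
- by rewrite cat_take_drop.
- by split=> //; rewrite size_takel.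
- by have [a ha] := sb; exists (a ++ take p b); rewrite -catA cat_take_drop.
Qed.

Definition good_cut (L K : nat) (ab : seq nat * seq nat) : Prop :=
  [/\ (L <= size ab.1)%N, (L <= size ab.2)%N,
      small K (drop (size ab.1 - p) ab.1) & small K (take p ab.2)].

(** Pairs with a word shorter than [L] are bounded against summable, hence contribute O(1). In the
    other bad pairs a part exceeding [K] lies near the cut: words of that kind carry a factor
    [r ^+ K], and pairing them with the other side costs [n.+1]. The constant [E] is fixed before
    [K]. *)
Lemma bad_cuts_bound L : (p <= L)%N -> exists E : R, forall K n,
  (cnt_pairs ((prefixes C `*` suffixes C) `\` good_cut L K) n)%:R * r ^+ n <=
  E * (n.+1%:R * r ^+ K + 1).
Proof.
move=> pL; have [D1 h1] := prefixes_wbounded; have [D2 h2] := suffixes_wbounded.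
have [G hG] := wsummable_short r_gt0 r_lt1 p.
have [G' hG'] := wsummable_short r_gt0 r_lt1 L.
have D10 := wbounded_ge0 r_gt0 h1; have D20 := wbounded_ge0 r_gt0 h2.
have G0 := wsummable_ge0 hG; have G'0 := wsummable_ge0 hG'.
have r1 : 0 < 1 - r by rewrite subr_gt0.
pose w := r / (1 - r); have w0 : 0 <= w by rewrite divr_ge0 // ltW.
exists ((D2 * G' + D1 * G') + 2 * (D1 * D2 * G * w)) => K n.
have hL : wsummable r (w * r ^+ K) (cnt (large K)).
  have -> : w * r ^+ K = r ^+ K.+1 / (1 - r) by rewrite exprS /w mulrAC.
  exact: wsummable_large.
(* Prefixes with a part exceeding [K] among the last [p] parts, and below it the mirror image for
   suffixes. *)
pose PB := concat (prefixes C) (concat (large K) (short p)).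
pose BS := concat (concat (short p) (large K)) (suffixes C).
have hPB : wbounded r (D1 * (w * r ^+ K * G)) (cnt PB).
  apply: (le_wbounded r_gt0 (fun n => cnt_concat _ _ n)).
  apply: (wbounded_convol r_gt0 h1).
  apply: (le_wsummable r_gt0 (fun n => cnt_concat _ _ n)).
  exact: wsummable_convol.
have hBS : wbounded r (D2 * (w * r ^+ K * G)) (cnt BS).
  apply: (le_wbounded r_gt0 (y := convol (cnt (suffixes C))
    (cnt (concat (short p) (large K))))) => [k|].
    by rewrite convolC; exact: cnt_concat.
  apply: (wbounded_convol r_gt0 h2).
  apply: (le_wsummable r_gt0 (fun n => cnt_concat _ _ n)).
  by rewrite mulrC; exact: wsummable_convol.
apply: le_trans (_ : (convol (cnt (suffixes C)) (cnt (short L)) n +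
    convol (cnt (prefixes C)) (cnt (short L)) n +
    (convol (cnt PB) (cnt (suffixes C)) n + convol (cnt (prefixes C)) (cnt BS) n))%N%:R
    * r ^+ n <= _).
  rewrite ler_wpM2r ?exprn_ge0 ?(ltW r_gt0) // ler_nat.
  rewrite convolC -!cnt_pairsX.
  apply: leq_trans (leq_trans (cnt_pairsU (_ `|` _) (_ `|` _) n)
    (leq_add (cnt_pairsU _ _ n) (cnt_pairsU _ _ n))).
  apply: leq_cnt_pairs => a b ca cb [[/= pa sb]].
  have [aL|La] := ltnP (size a) L; first by left; left.
  have [bL|Lb] := ltnP (size b) L; first by left; right.
  have [sa|/not_small_cat[u [x [v [ed Kx]]]]] := boolP (small K (drop (size a - p) a)).
    have [small_b|/not_small_cat[u [x [v [ed Kx]]]]] := boolP (small K (take p b)).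
      by case.
    move=> _; right; right; split=> //.
    have := congr1 size ed; rewrite size_takel ?(leq_trans pL) // !size_cat /= => sp.
    exists (u ++ [:: x]), (v ++ drop p b); split.
    - by rewrite -{1}(cat_take_drop p b) ed -!catA.
    - exists u, [:: x]; split=> //; first by rewrite /short /=; lia.
      by exists x.
    - have [c hc] := sb; exists (c ++ u ++ [:: x]).
      by rewrite -!catA; move: hc; rewrite -{1}(cat_take_drop p b) ed -!catA.
  move=> _; right; left; split=> //.
  have := congr1 size ed; rewrite size_drop subKn ?(leq_trans pL) // !size_cat /= => sp.
  exists (take (size a - p) a ++ u), ([:: x] ++ v); split.
  - by rewrite -{1}(cat_take_drop (size a - p) a) ed -!catA.
  - have [c hc] := pa; exists ([:: x] ++ v ++ c).
    by move: hc; rewrite -{1}(cat_take_drop (size a - p) a) ed -!catA.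
  - exists [:: x], v; split=> //; first by exists x.
    by rewrite /short /=; lia.
have b1 := wbounded_convol r_gt0 h2 hG' n.
have b2 := wbounded_convol r_gt0 h1 hG' n.
have b3 := convol_wbounded r_gt0 n hPB h2.
have b4 := convol_wbounded r_gt0 n h1 hBS.
set rhs := (X in _ <= X); rewrite !natrD !mulrDl /rhs {rhs}.
apply: le_trans (lerD (lerD b1 b2) (lerD b3 b4)) _.
set F := D1 * D2 * G * w.
have F0 : 0 <= F by rewrite /F mulr_ge0 // mulr_ge0 // mulr_ge0.
have H0 : 0 <= D2 * G' + D1 * G' by rewrite addr_ge0 ?mulr_ge0.
have t0 : 0 <= n.+1%:R * r ^+ K by rewrite mulr_ge0 ?exprn_ge0 ?(ltW r_gt0).
have -> : n.+1%:R * (D1 * (w * r ^+ K * G) * D2) +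
    n.+1%:R * (D1 * (D2 * (w * r ^+ K * G)))
  = 2 * F * (n.+1%:R * r ^+ K) by rewrite /F; ring.
move: (n.+1%:R * r ^+ K) t0 => t t0; nra.
Qed.

End ClassBounds.

(** * Limits *)

Section Limits.
Variable R : realType.

Lemma cvg_le_dist0 (f g : R^nat) (l : R) :
  (forall n, `|f n - l| <= g n) -> g @ \oo --> 0 -> f @ \oo --> l.
Proof.
move=> fg g0; apply/cvgrPdist_le => e e0; move/cvgrPdist_le: g0 => /(_ e e0).
apply: filterS => n; rewrite sub0r normrN distrC => h.
by apply: le_trans (fg n) (le_trans (ler_norm _) h).
Qed.

(** The error is bounded by a multiple of the Cesaro mean of the distances from [x] to [A], because
    [x] is bounded. *)
Lemma cvg_convol_mean (x : R^nat) (A : R) : x @ \oo --> A ->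
  (fun n => n.+1%:R^-1 * \sum_(i < n.+1) x i * x (n - i)%N) @ \oo --> A ^+ 2.
Proof.
move=> xA; have [M [_ hM]] : bounded_fun x.
  by apply: cvg_seq_bounded; apply/cvg_ex; exists A.
pose D := M + 1; have xD n : `|x n| <= D by apply: hM => //; rewrite ltrDl.
pose d n := `|x n - A|.
have d0 : d @ \oo --> 0.
  have := cvg_norm (cvgB xA (cvg_cst A)); rewrite subrr normr0; exact.
apply: (@cvg_le_dist0 _ (fun n => (D + `|A|) * arithmetic_mean d n)); last first.
  by rewrite -[X in _ --> X](mulr0 (D + `|A|)); apply: cvgMr; exact: cesaro d0.
move=> n; rewrite /arithmetic_mean /= /series /= big_mkord.
have n0 : (n.+1%:R : R) != 0 by rewrite pnatr_eq0.
have -> : A ^+ 2 = n.+1%:R^-1 * \sum_(i < n.+1) A ^+ 2.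
  by rewrite sumr_const card_ord -[X in _ * X]mulr_natl mulKf.
rewrite -mulrBr -sumrB normrM ger0_norm ?invr_ge0 // mulrCA ler_wpM2l ?invr_ge0 //.
rewrite mulrDl; apply: le_trans (ler_norm_sum _ _ _) _.
apply: le_trans (_ : \sum_(i < n.+1) (D * d i + `|A| * d (n - i)%N) <= _).
  apply: ler_sum => i _; have -> : x i * x (n - i)%N - A ^+ 2 =
    x (n - i)%N * (x i - A) + A * (x (n - i)%N - A) by ring.
  apply: le_trans (ler_normD _ _) _; rewrite !normrM lerD //.
  by rewrite ler_wpM2r.
rewrite big_split /= -!mulr_sumr lerD //.
rewrite ler_wpM2l // [leRHS](reindex_inj rev_ord_inj) /=.
by apply: ler_sum => i _; rewrite subSS.
Qed.

Lemma equiv_cvg_ratio (f w : R^nat) (A : R) : (forall n, 0 < w n) ->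
  f ~_\oo (fun n => A * w n) -> (fun n => f n / w n) @ \oo --> A.
Proof.
move=> w0 /eqaddoP h; apply/cvgrPdist_le => e e0.
have A1 : 0 < `|A| + 1 by rewrite ltr_wpDl.
have := h (e / (`|A| + 1)) (divr_gt0 e0 A1); apply: filterS => n /= hn.
have -> : A - f n / w n = (A * w n - f n) / w n by field; exact: lt0r_neq0.
rewrite normrM normfV (gtr0_norm (w0 n)) ler_pdivrMr // distrC.
apply: le_trans hn _; rewrite normrM (gtr0_norm (w0 n)) mulrA
   ler_wpM2r ?(ltW (w0 n)) //.
by rewrite mulrAC ler_pdivrMr // ler_wpM2l ?(ltW e0) // lerDl.
Qed.

Lemma sum_comps_of (C : set (seq nat)) n (F : seq nat -> R) :
  C `<=` [set c | composition c] ->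
  \sum_(c <- fset_set (comps_of C n)) F c = \sum_(c <- words n | `[<C c>]) F c.
Proof.
move=> CC; rewrite -[RHS]big_filter; apply/perm_big/uniq_perm.
- exact: fset_uniq.
- exact/filter_uniq/fset_uniq.
move=> c; rewrite mem_filter mem_words in_fset_set; last exact: finite_comps_of.
apply/idP/and3P => [|[/asboolP Cc _ /eqP sc]]; last by rewrite inE.
by rewrite inE => -[Cc ->]; split=> //; [exact/asboolP|exact: CC].
Qed.

Lemma mean_parts_cnt (C : set (seq nat)) k n : C `<=` [set c | composition c] ->
  (0 < k)%N -> mean_parts R C k (n + k) =
  (cnt_pairs [set ab | C (ab.1 ++ k :: ab.2)] n)%:R / (cnt C (n + k))%:R.
Proof.
move=> CC k0; rewrite /mean_parts num_comps_cnt // sum_comps_of //.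
rewrite -[in RHS](addnK k n) -sum_count_mem ?leq_addl // addnK natr_sum.
by rewrite /num_parts gtn_eqF.
Qed.

Lemma part_ratioM_density (C : set (seq nat)) k n : (0 < k)%N ->
  part_ratio R C k n * part_density R C n = mean_parts R C k n / n%:R.
Proof.
move=> k0; rewrite /part_ratio /part_density.
(* If the mean number of parts is 0, the ratio is 0 by the convention for division; the mean number
   of parts [k], being no larger, is then 0 as well. *)
have [m0|m0] := eqVneq (mean_parts R C 0 n) 0; last by rewrite mulrA divfK.
suff -> : mean_parts R C k n = 0 by rewrite !mul0r.
have le_mean : mean_parts R C k n <= mean_parts R C 0 n.
  rewrite /mean_parts ler_wpM2r ?invr_ge0 //; apply: ler_sum => c _.
  by rewrite ler_nat /num_parts gtn_eqF //= count_size.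
apply/le_anti; rewrite -{1}m0 le_mean /mean_parts /= divr_ge0 //.
by apply: sumr_ge0.
Qed.

(** Both counts are multiplied by [r ^+ n] and divided by [n.+1]. The convolution then tends to
    [A ^+ 2], the number of cuts at [k] tends to the term with [u] and [mu], and the constant 1 in
    the error disappears. *)
Lemma part_freq_bound (C : set (seq nat)) (r A mu u E : R) k K :
  0 < r -> 0 < A -> (0 < k)%N -> C `<=` [set c | composition c] ->
  (fun n => (cnt C n)%:R * r ^+ n) @ \oo --> A ->
  part_ratio R C k @ \oo --> u -> part_density R C @ \oo --> mu ->
  (forall n, `|(cnt_pairs [set ab | C (ab.1 ++ k :: ab.2)] n)%:R -
     (convol (cnt C) (cnt C) n)%:R| * r ^+ n <= E * (n.+1%:R * r ^+ K + 1)) ->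
  `|u / r ^+ k * mu * A - A ^+ 2| <= E * r ^+ K.
Proof.
move=> r0 A0 k0 CC hA hu hmu hb.
pose x n := (cnt C n)%:R * r ^+ n.
pose s n := n.+1%:R^-1 * \sum_(i < n.+1) x i * x (n - i)%N.
have hs : s @ \oo --> A ^+ 2 by exact: cvg_convol_mean.
pose N n : R := (cnt_pairs [set ab | C (ab.1 ++ k :: ab.2)] n)%:R.
pose y n := N n * r ^+ n * n.+1%:R^-1.
have bound n : `|y n - s n| <= E * (r ^+ K + harmonic n).
  have -> : s n = (convol (cnt C) (cnt C) n)%:R * r ^+ n * n.+1%:R^-1.
    by rewrite convol_weight mulrC.
  rewrite /y -mulrBl -mulrBl normrM (ger0_norm (_ : 0 <= n.+1%:R^-1)) ?invr_ge0 //.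
  rewrite normrM (ger0_norm (_ : 0 <= r ^+ n)) ?exprn_ge0 ?(ltW r0) //.
  rewrite ler_pdivrMr // (le_trans (hb n)) //.
  rewrite /= -mulrA mulrDl [r ^+ K * _]mulrC mulVf // pnatr_eq0 //.
have hy : y @ \oo --> u / r ^+ k * mu * A.
  (* This is [(n + k) / (n + 1)]: the density at weight [n + k] divides by [n + k], whereas [y n]
     divides by [n + 1]. *)
  pose q (n : nat) : R := 1 + (k%:R - 1) * harmonic n.
  have hq : q @ \oo --> (1 : R).
    rewrite -[X in _ --> X]addr0; apply: cvgD; first exact: cvg_cst.
    rewrite -[X in _ --> X](mulr0 (k%:R - 1)); apply: cvgMr.
    exact: cvg_harmonic.
  have h1 : (fun n => part_ratio R C k (n + k) * part_density R C (n + k) *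
      x (n + k)%N * q n / r ^+ k) @ \oo --> u * mu * A * 1 / r ^+ k.
    apply: cvgM; last exact: cvg_cst.
    apply: cvgM; last exact: hq.
    apply: cvgM; last by have := hA; rewrite -(cvg_shiftn k); exact.
    apply: cvgM; first by have := hu; rewrite -(cvg_shiftn k); exact.
    by have := hmu; rewrite -(cvg_shiftn k); exact.
  have -> : u / r ^+ k * mu * A = u * mu * A * 1 / r ^+ k by ring.
  apply: cvg_trans h1; apply: near_eq_cvg.
  have hAk : (fun n => x (n + k)%N) @ \oo --> A.
    by have := hA; rewrite -(cvg_shiftn k); exact.
  (* For large [n] the class has members of weight [n + k], so the count in the denominator can be
     cancelled. *)
  move/cvgr_gt: hAk => /(_ 0 A0); apply: filterS => n xnk /=.
  rewrite part_ratioM_density // mean_parts_cnt // -/(N n) /y /q /harmonic /=.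
  have c0 : (cnt C (n + k))%:R != 0 :> R.
    by apply: contraTneq xnk => c0; rewrite /x c0 mul0r ltxx.
  rewrite /x exprD natrD -natr1.
  have n1 : n%:R + 1 != 0 :> R by rewrite natr1 pnatr_eq0.
  have nk : n%:R + k%:R != 0 :> R by rewrite -natrD pnatr_eq0 -lt0n addn_gt0 k0 orbT.
  have rn m : r ^+ m != 0 by rewrite expf_neq0 // gt_eqF.
  by field; rewrite n1 nk c0 rn.
have hl : (fun n => `|y n - s n|) @ \oo --> `|u / r ^+ k * mu * A - A ^+ 2|.
  by apply: cvg_norm; exact: (cvgB hy hs).
have hr : (fun n => E * (r ^+ K + harmonic n)) @ \oo --> E * (r ^+ K + 0).
  apply: cvgMr; apply: cvgD; first exact: cvg_cst.
  exact: cvg_harmonic.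
rewrite -[r ^+ K]addr0; apply: ler_cvg_to hl hr _.
by near do exact: bound.
Unshelve. all: by end_near.
Qed.

End Limits.

Lemma ler_norm_eq0_geometric (R : realType) (r E a : R) : 0 < r -> r < 1 ->
  (forall K, `|a| <= E * r ^+ K) -> a = 0.
Proof.
move=> r0 r1 h; apply/normr0_eq0/le_anti; rewrite normr_ge0 andbT.
apply/ler_addgt0Pr => e e0; rewrite add0r.
have E0 : 0 <= E by have := h 0%N; rewrite expr0 mulr1; exact: le_trans.
by have [K hK] := exists_geometric_le r0 r1 E0 e0; exact: le_trans (h K) hK.
Qed.

Theorem theorem2 (R : realType) (C : set (seq nat)) (A r B : R)
  (hC : asymptotically_free_class C)
  (hA : 0 < A) (hr0 : 0 < r) (hr1 : r < 1)
  (hcount : (fun n : nat => (num_comps C n)%:R : R)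
              ~_\oo (fun n : nat => A * r ^- n))
  (hfree : exists l : nat, forall a b : seq nat,
     composition a -> composition b ->
     (l <= size a)%N -> (l <= size b)%N ->
     (infinite_set [set x : nat | (0 < x)%N /\ C (a ++ x :: b)]
        <-> C a /\ C b))
  (hu : forall k : nat, (0 < k)%N -> cvgn (part_ratio R C k))
  (hB : 0 < B)
  (huB : part_freq R C ~_\oo (fun k : nat => B * r ^+ k))
  (hmu : cvgn (part_density R C)) :
  B * limn (part_density R C) = A.
Proof.
have [m [p [m0 p0 [Phi [finPhi simPhi afPhi defC]]]]] := hC.
have [l free] := hfree.
have CC : C `<=` [set c | composition c] by rewrite defC => c [phi _ []].
have hx : (fun n => (cnt C n)%:R * r ^+ n) @ \oo --> A.
  have := equiv_cvg_ratio (w := fun n => r ^- n) _ hcount.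
  under eq_fun do rewrite num_comps_cnt // invrK; apply=> n.
  by rewrite invr_gt0 exprn_gt0.
have [D hD] : exists D, wbounded r D (cnt C).
  have [M [_ hM]] : bounded_fun (fun n => (cnt C n)%:R * r ^+ n : R).
    by apply: cvg_seq_bounded; apply/cvg_ex; exists A.
  exists (M + 1) => n; apply: le_trans (ler_norm _) _.
  by apply: hM => //; rewrite ltrDl.
pose L := maxn l (p + p).
have [E hE] : exists E : R, forall K n,
    (cnt_pairs ((prefixes C `*` suffixes C) `\` good_cut p L K) n)%:R * r ^+ n <=
    E * (n.+1%:R * r ^+ K + 1).
  apply: (bad_cuts_bound hr0 hr1 p0 CC hD).
  - by rewrite defC; exact: prefix_completions.
  - by rewrite defC; exact: suffix_completions.
  - by rewrite /L; lia.
(* Only the threshold [M] depends on [K]; [E] serves all [K]. *)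
have freq K : exists M, forall k, (M <= k)%N -> (0 < k)%N ->
    `|part_freq R C k / r ^+ k * limn (part_density R C) * A - A ^+ 2| <= E * r ^+ K.
  have [M hM] : exists M, forall a b k, prefixes C a -> suffixes C b ->
      (L <= size a)%N -> (L <= size b)%N ->
      small K (drop (size a - p) a) -> small K (take p b) -> (M <= k)%N ->
      C (a ++ k :: b) <-> C a /\ C b.
    by rewrite /L defC; apply: (class_cut m0 finPhi simPhi afPhi); rewrite -defC.
  exists M => k Mk k0; apply: (part_freq_bound hr0 hA k0 CC hx (hu k k0) hmu).
  move=> n; apply: le_trans (hE K n).
  rewrite ler_wpM2r ?exprn_ge0 ?(ltW hr0) // -cnt_pairsX.
  set T := [set ab | _]; set S := C `*` C; set bad := _ `\` _.
  have pre a b : T (a, b) -> prefixes C a /\ suffixes C b.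
    move=> Tab; split; first by exists (k :: b).
    by exists (a ++ [:: k]); rewrite -catA.
  (* [T] and [S] consist of pairs of a prefix and a suffix and agree on good pairs, so each exceeds
     the other by bad pairs at most. *)
  have TS : (cnt_pairs T n <= cnt_pairs S n + cnt_pairs bad n)%N.
    apply: leq_trans (cnt_pairsU S bad n); apply: leq_cnt_pairs => a b ca cb Tab.
    have [pa sb] := pre a b Tab.
    have [[La Lb sa small_b]|nb] := pselect (good_cut p L K (a, b)); last by right.
    by left; apply/(hM a b k).
  have ST : (cnt_pairs S n <= cnt_pairs T n + cnt_pairs bad n)%N.
    apply: leq_trans (cnt_pairsU T bad n); apply: leq_cnt_pairs => a b ca cb [/= Ca Cb].
    have pa : prefixes C a by exists [::]; rewrite cats0.
    have sb : suffixes C b by exists [::].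
    have [[La Lb sa small_b]|nb] := pselect (good_cut p L K (a, b)); last by right.
    by left; apply/(hM a b k).
  by rewrite ler_distl lerBlDr -!natrD !ler_nat ST TS.
set mu := limn _ in freq *.
have hB' : (fun k => part_freq R C k / r ^+ k) @ \oo --> B.
  by apply: equiv_cvg_ratio huB => k; rewrite exprn_gt0.
have hlim : (fun k => `|part_freq R C k / r ^+ k * mu * A - A ^+ 2|) @ \oo -->
    `|B * mu * A - A ^+ 2|.
  apply: cvg_norm; apply: cvgB; last exact: cvg_cst.
  by apply: cvgM; [apply: cvgM; [exact: hB'|exact: cvg_cst]|exact: cvg_cst].
have eq0 : B * mu * A - A ^+ 2 = 0.
  (* For fixed [K] the limit in [k] satisfies the same bound [E * r ^+ K]; [K] is arbitrary, so the
     limit is 0. Cancelling the positive factor [A] then gives the claim. *)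
  apply: (ler_norm_eq0_geometric hr0 hr1 (E := E)) => K; have [M hM] := freq K.
  apply: (cvgr_to_le hlim); exists (maxn M 1) => // k /=; rewrite geq_max => /andP[].
  exact: hM.
apply: (mulIf (lt0r_neq0 hA)); apply/eqP; rewrite -subr_eq0 -expr2; exact/eqP.
Qed.
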